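(* Let a wall mechanism $m$ occupy an inner region of dimensional thickness $\ell_m$, and write $\delta_m=\ell_m/L^*\ll1$, with $\alpha\delta_m\ll1$. Introduce the stretched coordinate $Y=y/\delta_m$. Suppose that, after nondimensionalisation, the inner disturbance problem has the linear form $$\mathcal L_m(\alpha,c;\delta_m)\,\mathbf U_m=\mathcal F_m(\alpha,c;\delta_m)\,\hat p_w,$$ where $\hat p_w=\hat p(0^+)$ is the outer wall pressure, and that the solution defines an outward inner flux $q_m=\mathcal Q_m\mathbf U_m$. Assume that the inner problem is well posed uniformly for $c$ in a fixed neighbourhood of the rigid-wall eigenvalue $c_0$, and that its flux admits the expansion $$q_m=-A_m(\alpha,c)\,\hat p_w+\mathcal O\big(\alpha\delta_m|\hat p_w|+\delta_m|\hat p_y(0^+)|\big).$$ Then the outer problem satisfies the effective admittance condition $$\hat v(0^+)=-A_m(\alpha,c)\,\hat p(0^+)+\mathcal O\big(\alpha\delta_m|\hat p(0^+)|+\delta_m|\hat p_y(0^+)|\big).$$ Equivalently, if the remainder is absorbed into the boundary condition (with $A=-\hat v(0^+)/\hat p(0^+)$, $\hat p(0^+)\ne0$), $$A=A_m+\mathcal O\big(\alpha\delta_m+\delta_m|\hat p_y(0^+)|/|\hat p(0^+)|\big).$$ If $N$ independent thin mechanisms of this type are forced by the same leading-order outer pressure and their fluxes are additive, then $$\hat v(0^+)=-\Big(\sum_{m=1}^N A_m\Big)\hat p(0^+)+\mathcal O\Big(\sum_{m=1}^N\alpha\delta_m|\hat p(0^+)|+\sum_{m=1}^N\delta_m|\hat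 p_y(0^+)|+\sum_{m\ne n}|A_mA_n||\hat p(0^+)|\Big),$$ and therefore $$A=\sum_{m=1}^N A_m+\mathcal O\Big(\sum_{m=1}^N\alpha\delta_m+\sum_{m=1}^N\delta_m|\hat p_y(0^+)|/|\hat p(0^+)|+\sum_{m\ne n}|A_mA_n|\Big).$$
   Context: The outer disturbance on a boundary layer over a wall at $y=0$ has complex pressure amplitude $\hat p(y)$ and wall-normal velocity amplitude $\hat v(y)$ (positive from the wall into the fluid), with real wavenumber $\alpha>0$ and complex phase speed $c$; $L^*$ is the outer length scale, $0^+$ denotes the bottom of the outer region, and $\hat p_y=d\hat p/dy$. The wall admittance seen by the outer flow is $A=-\hat v(0^+)/\hat p(0^+)$. For each mechanism $m$, $\mathcal L_m$ is a linear operator, $\mathcal F_m$ a linear forcing and $\mathcal Q_m$ a linear functional extracting the outward normal flux from the inner solution $\mathbf U_m$; ''well posed uniformly'' means that $\mathbf U_m$ exists, is unique and depends boundedly on $\hat p_w$, uniformly in $c$ in the neighbourhood. $A_m(\alpha,c)$ is the complex coefficient in the flux law. The flux is the quantity transmitted to the outer flow by matching of the normal velocity: for a single mechanism, $\hat v(0^+)=q_m$; ''fluxes are additive'' means $\hat v(0^+)=\sum_{m=1}^N q_m$. The $\mathcal O$-symbols refer to $\delta_m\to0$, $\alpha\delta_m\to 0$, with constants uniform in $c$ in the neighbourhood. *)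

(* Defs.v *)
From HB Require Import structures.
From mathcomp Require Import all_boot all_order all_algebra.
From mathcomp Require Import all_classical all_reals all_analysis.
From mathcomp Require Import complex.

Set Implicit Arguments.
Unset Strict Implicit.
Unset Printing Implicit Defensive.

Import Order.TTheory GRing.Theory Num.Theory numFieldNormedType.Exports.

Local Open Scope classical_set_scope.
Local Open Scope ring_scope.
Local Open Scope complex_scope.

Section ComplexAmplitudes.
Variable R : realType.

(* [R[i]^o] is [R[i]] seen as a normed module over itself; the topology, the
   limits and the Landau symbols used below live on that type. *)
Local Notation C := (R[i]^o).

Definition cderivable (f : R -> C) (y : R) : Prop :=
  derivable (fun t => complex.Re (f t)) y 1 /\
  derivable (fun t => complex.Im (f t)) y 1.

Definition cderive1 (f : R -> C) (y : R) : C :=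
  derive1 (fun t => complex.Re (f t)) y +i* derive1 (fun t => complex.Im (f t)) y.

(* The value at [0^+], the bottom of the outer region. *)
Definition at0p (f : R -> C) : C := lim (f @ 0^'+).

Record disturbance := Disturbance {
  phat : R -> C;
  vhat : R -> C;
  phat_derivable : \forall y \near 0^'+, cderivable phat y;
  phat_cvg : cvg (phat @ 0^'+);
  phat_y_cvg : cvg (cderive1 phat @ 0^'+);
  vhat_cvg : cvg (vhat @ 0^'+) }.

Definition p_wall (d : disturbance) : C := at0p (phat d).
Definition py_wall (d : disturbance) : C := at0p (cderive1 (phat d)).
Definition v_wall (d : disturbance) : C := at0p (vhat d).

Definition admittance (d : disturbance) : C := - v_wall d / p_wall d.

(* [c] is an eigenvalue of the outer problem closed by the rigid-wall condition
   [v(0^+) = 0]; [outer] is the set of solutions of the outer equations, without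
   wall condition. *)
Definition rigid_wall_eigenvalue (outer : set disturbance) : Prop :=
  exists d, [/\ outer d,
    exists2 y : R, 0 < y & (phat d y != 0) || (vhat d y != 0) &
    v_wall d = 0].

(* The outer flow enters only through the set of amplitude pairs that it allows
   for a given wavenumber and phase speed.  [wavenumbers] is the range of
   [alpha] over which the estimates are taken: a singleton for a fixed [alpha],
   and a larger set when [alpha] also varies in the limit. *)
Record outer_flow := OuterFlow {
  length_scale : R;
  wavenumbers : set R;
  outer : R -> C -> set disturbance;
  c0 : R -> C;
  c_nbhd : R -> set C;
  length_scale_gt0 : 0 < length_scale;
  wavenumbers_gt0 : forall alpha, wavenumbers alpha -> 0 < alpha;
  c0_eigenvalue : forall alpha, wavenumbers alpha ->
    rigid_wall_eigenvalue (outer alpha (c0 alpha));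
  c_nbhd_nbhs : forall alpha, wavenumbers alpha ->
    nbhs (c0 alpha) (c_nbhd alpha) }.

(* The inner disturbance [U], a field in the stretched coordinate, is a point of
   a normed space; the operator need not be bounded for its norm.  The last
   argument of [inner_op] and [forcing] is [delta]. *)
Record mechanism := Mechanism {
  state : normedModType R[i];
  data : lmodType R[i];
  inner_op : R -> C -> R -> {linear state -> data};
  forcing : R -> C -> R -> {linear C -> data};
  flux : {linear state -> C};
  coef : R -> C -> C }.

Definition inner_solution (M : mechanism) (alpha : R) (c : C) (delta : R)
    (pw : C) (U : state M) : Prop :=
  inner_op M alpha c delta U = forcing M alpha c delta pw.

Definition well_posed (O : outer_flow) (M : mechanism) : Prop :=
  exists2 e : R, 0 < e &
    forall alpha ell : R, let delta := ell / length_scale O in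
      wavenumbers O alpha -> 0 < ell -> delta < e -> alpha * delta < e ->
      exists K : R, forall c : C, c_nbhd O alpha c -> forall pw : C,
        exists U : state M,
          [/\ inner_solution alpha c delta pw U,
              forall U' : state M,
                inner_solution alpha c delta pw U' -> U' = U &
              `|U| <= K%:C * `|pw|].

Record wave := Wave {
  alpha : R;
  speed : C;
  amplitudes : disturbance }.

Definition admissible_wave (O : outer_flow) (w : wave) : Prop :=
  [/\ wavenumbers O (alpha w), c_nbhd O (alpha w) (speed w) &
      outer O (alpha w) (speed w) (amplitudes w)].

(* The filter of the limit [delta_m -> 0], [alpha delta_m -> 0] for all [m]: its
   sets do not constrain the other components of a configuration, so that a
   bigO along it has a constant uniform in the phase speed. *)
Definition thin_limit {T I : Type} (a : T -> R) (delta : T -> I -> R) :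
    set_system T :=
  filter_from [set e : R | 0 < e]
    (fun e => [set x | forall i, delta x i < e /\ a x * delta x i < e]).

Lemma thin_limit_filter {T I : Type} (a : T -> R) (delta : T -> I -> R) :
  Filter (thin_limit a delta).
Proof.
apply: filter_from_filter; first by exists 1; exact: ltr01.
move=> e1 e2 /= e1_gt0 e2_gt0; exists (Num.min e1 e2) => /=.
  by rewrite lt_min e1_gt0 e2_gt0.
move=> x xP; split=> i; have [] := xP i; rewrite !lt_min.
  by move=> /andP[-> _] /andP[-> _].
by move=> /andP[_ ->] /andP[_ ->].
Qed.

Section SingleMechanism.
Variables (O : outer_flow) (M : mechanism).

Record config := Config {
  cwave :> wave;
  thickness : R;
  inner_state : state M }.

Definition delta (x : config) : R := thickness x / length_scale O.
Definition pw (x : config) : C := p_wall (amplitudes x).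
Definition pyw (x : config) : C := py_wall (amplitudes x).
Definition vw (x : config) : C := v_wall (amplitudes x).
Definition adm (x : config) : C := admittance (amplitudes x).
Definition q (x : config) : C := flux M (inner_state x).
Definition A (x : config) : C := coef M (alpha x) (speed x).

Definition forced (x : config) : Prop :=
  [/\ admissible_wave O x, 0 < thickness x &
      inner_solution (alpha x) (speed x) (delta x) (pw x) (inner_state x)].

Definition matched (x : config) : Prop := vw x = q x.

Definition thin (D : set config) : set_system config :=
  within D (thin_limit (@alpha \o cwave) (fun x (_ : unit) => delta x)).

Canonical thin_filter_on (D : set config) :=
  FilterType (thin D) (within_filter D (thin_limit_filter _ _)).

Definition remainder (x : config) : C :=
  (alpha x * delta x)%:C * `|pw x| + (delta x)%:C * `|pyw x|.

Definition rel_remainder (x : config) : C :=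
  (alpha x * delta x)%:C + (delta x)%:C * `|pyw x| / `|pw x|.

Definition flux_expansion : Prop :=
  let F := thin forced in q = (fun x => - A x * pw x) +O_F remainder.

Definition effective_condition (D : set config) : Prop :=
  let F := thin D in vw = (fun x => - A x * pw x) +O_F remainder.

Definition effective_admittance (D : set config) : Prop :=
  let F := thin D in adm = A +O_F rel_remainder.

End SingleMechanism.

Section SeveralMechanisms.
Variables (O : outer_flow) (N : nat) (M : 'I_N -> mechanism).

Record mconfig := MConfig {
  mwave :> wave;
  mthickness : 'I_N -> R;
  minner_state : forall m, state (M m) }.

Definition mdelta (x : mconfig) (m : 'I_N) : R :=
  mthickness x m / length_scale O.
Definition mpw (x : mconfig) : C := p_wall (amplitudes x).
Definition mpyw (x : mconfig) : C := py_wall (amplitudes x).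
Definition mvw (x : mconfig) : C := v_wall (amplitudes x).
Definition madm (x : mconfig) : C := admittance (amplitudes x).
Definition mq (x : mconfig) (m : 'I_N) : C := flux (M m) (minner_state x m).
Definition mA (x : mconfig) (m : 'I_N) : C := coef (M m) (alpha x) (speed x).

Definition mforced (x : mconfig) : Prop :=
  admissible_wave O x /\
  forall m, 0 < mthickness x m /\
    inner_solution (alpha x) (speed x) (mdelta x m) (mpw x) (minner_state x m).

Definition additive_fluxes (x : mconfig) : Prop := mvw x = \sum_(m < N) mq x m.

Definition mthin (D : set mconfig) : set_system mconfig :=
  within D (thin_limit (@alpha \o mwave) mdelta).

Canonical mthin_filter_on (D : set mconfig) :=
  FilterType (mthin D) (within_filter D (thin_limit_filter _ _)).

Definition cross (x : mconfig) : C :=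
  \sum_(m < N) \sum_(n < N | m != n) `|mA x m * mA x n|.

Definition mremainder (x : mconfig) : C :=
  (\sum_(m < N) (alpha x * mdelta x m)%:C * `|mpw x|) +
  (\sum_(m < N) (mdelta x m)%:C * `|mpyw x|) +
  cross x * `|mpw x|.

Definition rel_mremainder (x : mconfig) : C :=
  (\sum_(m < N) (alpha x * mdelta x m)%:C) +
  (\sum_(m < N) (mdelta x m)%:C * `|mpyw x| / `|mpw x|) +
  cross x.

Definition effective_mcondition (D : set mconfig) : Prop :=
  let F := mthin D in
  mvw = (fun x => - (\sum_(m < N) mA x m) * mpw x) +O_F mremainder.

Definition effective_madmittance (D : set mconfig) : Prop :=
  let F := mthin D in
  madm = (fun x => \sum_(m < N) mA x m) +O_F rel_mremainder.

End SeveralMechanisms.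

End ComplexAmplitudes.

(* Main.v *)
(** By matching, the flux expansion is the wall condition.  Since
    [admittance - A_m = - (v_wall + A_m * p_wall) / p_wall] and the remainder is
    [`|p_wall|] times the relative one, dividing by the wall pressure gives the
    admittance form.  Several mechanisms: sum the individual expansions; the
    cross terms are nonnegative and only enlarge the remainder. *)

Require Import Defs.
From mathcomp Require Import all_boot all_order all_algebra.
From mathcomp Require Import all_classical all_reals all_analysis.
From mathcomp Require Import complex.
Local Open Scope classical_set_scope.
Local Open Scope ring_scope.

Import Order.TTheory GRing.Theory Num.Theory numFieldNormedType.Exports.

Section BigO.
Context {K : numFieldType} {T : Type}.
Implicit Types (F : filter_on T) (f g e : T -> K^o).

Lemma eqaddO_exP F f g e : f = g +O_F e <->
  exists2 k : K, 0 < k & \forall x \near F, `|f x - g x| <= k * `|e x|.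
Proof. apply: iff_trans (eqaddOP _ _ _ _) _; exact: iff_sym (bigO_exP _ _ _). Qed.

(** A factor that scales the error and the remainder alike cancels from the estimate, with the same
    constant [k], wherever it is nonzero. Here [p] will be the wall pressure. *)
Lemma eqaddO_rescale F (p f g e f' g' e' : T -> K^o) :
  (\forall x \near F, [/\ p x != 0,
    `|f x - g x| = `|f' x - g' x| * `|p x| & `|e x| = `|e' x| * `|p x|]) ->
  f = g +O_F e <-> f' = g' +O_F e'.
Proof.
move=> Fp.
by split=> /eqaddO_exP[k k0 H]; apply/eqaddO_exP; exists k => //;
  apply: filterS2 Fp H => x [p0 fE eE]; rewrite fE eE mulrA ler_pM2r ?normr_gt0.
Qed.

End BigO.

Section ThinLimit.
Context {R : realType}.
Local Notation C := (R[i]^o).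

(** Both [k] and [eps] are fixed before [x], which makes the uniformity in the phase speed explicit.
    In this form, estimates over different domains or different types of configurations can be
    compared. *)
Lemma eqaddO_thinP {T I : Type} (a : T -> R) (delta : T -> I -> R)
    (D : set T) (FF : Filter (within D (thin_limit a delta)))
    (f g e : T -> C) :
  (let F := FilterType (within D (thin_limit a delta)) FF in f = g +O_F e) <->
  exists2 k : R[i], 0 < k & exists2 eps : R, 0 < eps & forall x, D x ->
    (forall i, delta x i < eps /\ a x * delta x i < eps) ->
    `|f x - g x| <= k * `|e x|.
Proof.
split=> [/eqaddO_exP[k k0 [eps eps0 H]]|[k k0 [eps eps0 H]]].
  by exists k => //; exists eps => // x Dx xP; exact: H.
by apply/eqaddO_exP; exists k => //; exists eps => // x xP Dx; exact: H.
Qed.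

End ThinLimit.

Section OneMechanism.
Context {R : realType} (O : outer_flow R) {M : mechanism R}.
Implicit Types (D : set (config M)) (x : config M).

Lemma effective_condition_admittance D : D `<=` [set x | pw x != 0] ->
  effective_condition O D <-> effective_admittance O D.
Proof.
move=> Dp; apply: (@eqaddO_rescale _ _ _ (@pw R M)).
(* The threshold is arbitrary: the wall pressure is nonzero on all of [D], however thick the
   layer. *)
exists 1 => //= x _ /Dp p0; split => //.
  rewrite -normrM /adm /admittance -/(vw x) -/(pw x) mulrBl divfK //.
  by rewrite mulNr opprK -opprD normrN.
have n0 : `|pw x| != 0 by rewrite normr_eq0.
by rewrite -[in RHS](normr_id (pw x)) -normrM /rel_remainder mulrDl divfK.
Qed.

(** Serves to restrict to nonzero wall pressure before dividing by it. *)
Lemma effective_conditionS D D' : D' `<=` D ->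
  effective_condition O D -> effective_condition O D'.
Proof.
move=> sDD' /eqaddO_thinP[k k0 [eps eps0 H]].
apply/eqaddO_thinP; exists k => //; exists eps => // x /sDD'; exact: H.
Qed.

Lemma effective_condition_matched : flux_expansion O M ->
  effective_condition O (forced O (M := M) `&` matched (M := M)).
Proof.
move=> /eqaddO_thinP[k k0 [eps eps0 H]].
apply/eqaddO_thinP; exists k => //; exists eps => // x [fx ->]; exact: H.
Qed.

End OneMechanism.

Section SeveralMechanisms.
Context {R : realType} (O : outer_flow R) {N : nat} {M : 'I_N -> mechanism R}.
Implicit Types (D : set (mconfig M)) (x : mconfig M).

Lemma effective_mcondition_madmittance D : D `<=` [set x | mpw x != 0] ->
  effective_mcondition O D <-> effective_madmittance O D.
Proof.
move=> Dp; apply: (@eqaddO_rescale _ _ _ (@mpw R N M)).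
exists 1 => //= x _ /Dp p0; split => //.
  rewrite -normrM /madm /admittance -/(mvw x) -/(mpw x) mulrBl divfK //.
  by rewrite mulNr opprK -opprD normrN.
have n0 : `|mpw x| != 0 by rewrite normr_eq0.
rewrite -[in RHS](normr_id (mpw x)) -normrM /rel_mremainder !mulrDl.
congr (`| _ + _ + _ |); rewrite mulr_suml //.
by apply: eq_bigr => m _; rewrite divfK.
Qed.

Lemma effective_mconditionS D D' : D' `<=` D ->
  effective_mcondition O D -> effective_mcondition O D'.
Proof.
move=> sDD' /eqaddO_thinP[k k0 [eps eps0 H]].
apply/eqaddO_thinP; exists k => //; exists eps => // x /sDD'; exact: H.
Qed.

(** Keeps the common wave and forgets the other mechanisms, so that the expansion of [M m] alone
    applies. *)
Definition single x (m : 'I_N) : config (M m) :=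
  Config x (mthickness x m) (minner_state x m).

Lemma forced_single x m : mforced O x -> forced O (single x m).
Proof. by case=> ? /(_ m)[]. Qed.

Lemma remainder_single_ge0 x m : mforced O x -> 0 <= remainder O (single x m).
Proof.
move=> [[/wavenumbers_gt0 a0 _ _] /(_ m)[t0 _]].
have d0 : 0 <= delta O (single x m).
  by rewrite divr_ge0 ?ltW ?length_scale_gt0.
by rewrite addr_ge0 // mulr_ge0 // ler0c // mulr_ge0 // ltW.
Qed.

(** The two sides differ exactly by the cross term, a product of sums of norms with a norm. *)
Lemma sum_remainder_single_le x :
  \sum_m remainder O (single x m) <= mremainder O x.
Proof.
rewrite /mremainder -big_split /= lerDl mulr_ge0 // sumr_ge0 // => m _.
by rewrite sumr_ge0.
Qed.

Lemma effective_mcondition_additive : (forall m, flux_expansion O (M m)) ->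
  effective_mcondition O (mforced O (M := M) `&` additive_fluxes (M := M)).
Proof.
move=> HM.
(* Constant and threshold are paired so that a single use of choice selects both for every [m]. *)
have {}HM m : exists ke : R[i] * R, [/\ 0 < ke.1, 0 < ke.2 &
    forall y : config (M m), forced O y ->
      delta O y < ke.2 /\ alpha y * delta O y < ke.2 ->
      `|q y - - A y * pw y| <= ke.1 * `|remainder O y|].
  have /eqaddO_thinP[k k0 [eps eps0 H]] := HM m.
  by exists (k, eps); split=> // x fx xP; exact: H.
have /choice[ke keP] := HM.
(* The sum dominates each individual constant; the added 1 keeps it positive even when [N = 0]. *)
apply/eqaddO_thinP; exists (1 + \sum_m (ke m).1).
  by rewrite ltr_pwDl // sumr_ge0 // => m _; case: (keP m) => /ltW.
(* Below this minimum all the individual thresholds are met at once; the default 1 covers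
   [N = 0]. *)
exists (\big[Num.min/1]_m (ke m).2).
  by apply: lt_bigmin => // m _; case: (keP m).
move=> x [fx ->] xP.
rewrite mulNr opprK mulr_suml -big_split /=.
apply: le_trans (ler_norm_sum _ _ _) _.
have S0 : 0 <= \sum_m remainder O (single x m).
  by rewrite sumr_ge0 // => m _; exact: remainder_single_ge0.
have R0 := le_trans S0 (sum_remainder_single_le x).
have K0 m : 0 <= (ke m).1 by case: (keP m) => /ltW.
rewrite (ger0_norm R0).
apply: le_trans (ler_wpM2l _ (sum_remainder_single_le x)); last first.
  by rewrite addr_ge0 // sumr_ge0.
rewrite mulr_sumr ler_sum // => m _.
have [_ _ /(_ (single x m) (forced_single _ m fx))] := keP m.
rewrite (ger0_norm (remainder_single_ge0 _ m fx)) mulNr opprK => H.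
apply: (le_trans (H _)).
  have [d1 d2] := xP m.
  by split; [apply: lt_le_trans d1 _|apply: lt_le_trans d2 _]; exact: bigmin_le.
(* Isolating the constant of [m] in the total leaves 1 plus the other constants, which is
   nonnegative. *)
rewrite ler_wpM2r ?remainder_single_ge0 // (bigD1 m) //= addrCA lerDl.
by rewrite addr_ge0 // sumr_ge0.
Qed.

End SeveralMechanisms.

Theorem proposition2 (R : realType) (O : outer_flow R) :
  (forall M : mechanism R,
     (forall D : set (config M), D `<=` [set x | pw x != 0] ->
        effective_condition O D <-> effective_admittance O D) /\
     (well_posed O M -> flux_expansion O M ->
        effective_condition O (forced O (M := M) `&` matched (M := M)) /\
        effective_admittance O
          (forced O (M := M) `&` matched (M := M) `&` [set x | pw x != 0]))) /\
  (forall (N : nat) (M : 'I_N -> mechanism R),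
     (forall m, well_posed O (M m) /\ flux_expansion O (M m)) ->
     effective_mcondition O (mforced O (M := M) `&` additive_fluxes (M := M)) /\
     effective_madmittance O
       (mforced O (M := M) `&` additive_fluxes (M := M)
        `&` [set x | mpw x != 0])).
Proof.
split=> [M|N M HM]; split.
- exact: effective_condition_admittance.
- move=> _ /effective_condition_matched H; split=> //.
  apply/effective_condition_admittance; first exact: subIsetr.
  by apply: effective_conditionS H; exact: subIsetl.
- by apply: effective_mcondition_additive => m; have [] := HM m.
- apply/effective_mcondition_madmittance; first exact: subIsetr.
  apply: effective_mconditionS (@subIsetl _ _ _) _.
  by apply: effective_mcondition_additive => m; have [] := HM m.
Qed.
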